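(* Let $\mathfrak{L}=\mathfrak{I}\oplus\mathfrak{V}$ be a Leibniz algebra over a field $\mathbb{F}$ with multiplicative basis $\mathcal{B}=\mathcal{B}_{\mathfrak{I}}\,\dot\cup\,\mathcal{B}_{\mathfrak{V}}$. Then the following statements are equivalent: (i) $\mathfrak{L}$ is minimal (with respect to $\mathcal{B}$). (ii) Both graphs $\Gamma(\mathfrak{L},\mathcal{B}_{\mathfrak{I}})$ and $\Gamma(\mathfrak{L},\mathcal{B}_{\mathfrak{V}})$ are strongly connected. (iii) $\mathcal{B}$ is of weak division and both graphs $\Gamma(\mathfrak{L},\mathcal{B}_{\mathfrak{I}})$ and $\Gamma(\mathfrak{L},\mathcal{B}_{\mathfrak{V}})$ are connected.
   Context: A Leibniz algebra $\mathfrak{L}$ over an arbitrary field $\mathbb{F}$ is a vector space (of arbitrary dimension) with a bilinear product $[\cdot,\cdot]$ satisfying $[[y,z],x]=[[y,x],z]+[y,[z,x]]$ for all $x,y,z\in\mathfrak{L}$. An ideal of $\mathfrak{L}$ is a subspace $S$ (in particular a subalgebra) with $[S,\mathfrak{L}]+[\mathfrak{L},S]\subset S$. For $v\in\mathfrak{L}$, $\mathcal{I}(v)$ denotes the ideal of $\mathfrak{L}$ generated by $v$. Let $\mathfrak{I}$ be the ideal generated by $\{[x,x]:x\in\mathfrak{L}\}$; it satisfies $[\mathfrak{L},\mathfrak{I}]=0$. Let $\mathfrak{V}$ be a linear complement of $\mathfrak{I}$, so $\mathfrak{L}=\mathfrak{I}\oplus\mathfrak{V}$. Multiplicative basis: for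 a general algebra, a basis is multiplicative if for any two basis elements $v,v'$ one has $[v,v']\in\mathbb{F}v''$ for some basis element $v''$. For $\mathfrak{L}$, because $[\mathfrak{L},\mathfrak{I}]=0$, a basis $\mathcal{B}=\mathcal{B}_{\mathfrak{I}}\,\dot\cup\,\mathcal{B}_{\mathfrak{V}}$, where $\mathcal{B}_{\mathfrak{I}}=\{e_k\}_{k\in K}$ is a basis of $\mathfrak{I}$ and $\mathcal{B}_{\mathfrak{V}}=\{u_j\}_{j\in J}$ is a basis of $\mathfrak{V}$, is called multiplicative if (i) for any $k\in K$, $j\in J$ we have $[e_k,u_j]\in\mathbb{F}e_i$ for some $i\in K$; and (ii) for any $j,k\in J$ either $[u_j,u_k]\in\mathbb{F}u_l$ for some $l\in J$, or $[u_j,u_k]\in\mathbb{F}e_i$ for some $i\in K$. Minimal: $\mathfrak{L}$ is minimal if its only non-zero ideals admitting a multiplicative basis contained in $\mathcal{B}$ are $\mathfrak{I}$ and $\mathfrak{L}$. Here ''admitting a multiplicative basis contained in $\mathcal{B}$'' means having a basis that is a subset of $\mathcal{B}$ and is multiplicative in the general sense above. Graphs: $\Gamma(\mathfrak{L},\mathcal{B})=(V,E)$ is the directed graph with $V=\mathcal{B}$ and $E=\{(v,v')\in V\times V:\{[w,v],[v,w]\}\cap\mathbb{F}^{\times}v'\neq\emptyset\text{ for some }w\in\mathcal{B}\}$, $\mathbb{F}^\times=\mathbb{F}\setminus\{0\}$. $\Gamma(\mathfrak{L},\mathcal{B}_{\mathfrak{I}})$ and $\Gamma(\mathfrak{L},\mathcal{B}_{\mathfrak{V}})$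 are the vertex-induced subgraphs of $\Gamma(\mathfrak{L},\mathcal{B})$ on the vertex sets $\mathcal{B}_{\mathfrak{I}}$ and $\mathcal{B}_{\mathfrak{V}}$ respectively (all edges of $\Gamma(\mathfrak{L},\mathcal{B})$ with both endpoints in the given set). A directed path from $v$ to $v'$ is a finite sequence of vertices starting at $v$ and ending at $v'$ in which each pair of consecutive vertices $(w,w')$ is an edge; there is always a directed path using no edges from a vertex to itself. A graph is strongly connected if for any two vertices there are directed paths from each one to the other. A graph is connected if any two distinct vertices are joined by an undirected path, i.e. a finite sequence of vertices in which consecutive vertices $w,w'$ satisfy that $(w,w')$ or $(w',w)$ is an edge. Weak division: $\mathcal{B}$ is of weak division if, for basis elements $e_i,e_k\in\mathcal{B}_{\mathfrak{I}}$, $u_j\in\mathcal{B}_{\mathfrak{V}}$ and $\lambda\in\mathbb{F}$, $0\neq[e_i,u_j]=\lambda e_k$ implies $e_i\in\mathcal{I}(e_k)$; and for $u_i,u_k,u_p\in\mathcal{B}_{\mathfrak{V}}$ and $\lambda\in\mathbb{F}$, $0\neq[u_i,u_k]=\lambda u_p$ implies $u_i,u_k\in\mathcal{I}(u_p)$. *)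

(* Defs.v *)
From mathcomp Require Import all_boot all_algebra.
From mathcomp Require Import boolp classical_sets.

Set Implicit Arguments.
Unset Strict Implicit.
Unset Printing Implicit Defensive.

Import GRing.Theory.

Local Open Scope ring_scope.
Local Open Scope classical_set_scope.

(* Linear algebra in arbitrary dimension: subspaces and bases are classical   *)
(* sets of vectors, since vectType and {vspace _} are finite-dimensional.     *)
Section Bases.
Variables (F : fieldType) (L : lmodType F).
Implicit Types (S V A : set L).

Definition is_subspace S : Prop := GRing.submod_closed (mem S).

Definition linear_span A : set L := smallest is_subspace A.

Definition linearly_independent A : Prop :=
  forall (s : seq L) (c : L -> F),
    uniq s -> [set` s] `<=` A -> \sum_(x <- s) c x *: x = 0 ->
    forall x, x \in s -> c x = 0.

Definition is_basis S A : Prop :=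
  linearly_independent A /\ linear_span A = S.

Definition linear_complement S V : Prop :=
  [/\ is_subspace V, S `&` V = [set 0] & [set x + y | x in S & y in V] = setT].

Definition line (v : L) : set L := [set a *: v | a in setT].

Definition punctured_line (v : L) : set L := [set a *: v | a in [set~ 0]].

End Bases.

Section Digraphs.
Variable T : Type.

Record digraph := Digraph {
  vertices : set T;
  edge : T -> T -> Prop;
  edge_vertices : forall v w, edge v w -> vertices v /\ vertices w }.

Lemma induced_subproof (G : digraph) (A : set T) v w :
  [/\ A v, A w & edge G v w] ->
  (vertices G `&` A) v /\ (vertices G `&` A) w.
Proof. by move=> [Av Aw /edge_vertices[]]. Qed.

Definition induced_subgraph (G : digraph) (A : set T) : digraph :=
  Digraph (@induced_subproof G A).

(* A path is a vertex v followed by a list p of further vertices, possibly    *)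
(* empty, so every vertex has a path to itself.                               *)
Definition joined_by_path (e : T -> T -> Prop) (v w : T) : Prop :=
  exists p : seq T, path (fun x y => `[< e x y >]) v p /\ last v p = w.

Definition strongly_connected (G : digraph) : Prop :=
  forall v w, vertices G v -> vertices G w ->
    joined_by_path (edge G) v w /\ joined_by_path (edge G) w v.

Definition connected_graph (G : digraph) : Prop :=
  forall v w, vertices G v -> vertices G w -> v <> w ->
    joined_by_path (fun x y => edge G x y \/ edge G y x) v w.

End Digraphs.

Section LeibnizAlgebras.
Variables (F : fieldType) (L : lmodType F) (br : {bilinear L -> L -> L}).
Implicit Types (S V A B BI BV : set L).

Definition leibniz_identity : Prop :=
  forall x y z : L, br (br y z) x = br (br y x) z + br y (br z x).

Definition is_ideal S : Prop :=
  is_subspace S /\ forall s x, S s -> S (br s x) /\ S (br x s).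

Definition ideal_generated A : set L := smallest is_ideal A.

Definition leibniz_kernel : set L := ideal_generated [set br x x | x in setT].

Definition closed_multiplicatively A : Prop :=
  forall v v', A v -> A v' -> exists2 v'', A v'' & line v'' (br v v').

(* The notion of multiplicative basis for the decomposition of L into         *)
(* leibniz_kernel and V; products [u, e] with e in the kernel vanish and are  *)
(* not constrained.                                                           *)
Definition multiplicative_basis V BI BV : Prop :=
  [/\ is_basis leibniz_kernel BI,
      is_basis V BV,
      forall e u, BI e -> BV u -> exists2 e', BI e' & line e' (br e u)
    & forall u u', BV u -> BV u' ->
        (exists2 u'', BV u'' & line u'' (br u u')) \/
        (exists2 e, BI e & line e (br u u'))].

Definition admits_multiplicative_basis_in B S : Prop :=
  exists A, [/\ A `<=` B, is_basis S A & closed_multiplicatively A].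

Definition minimal_algebra B : Prop :=
  forall S, is_ideal S -> S <> [set 0] -> admits_multiplicative_basis_in B S ->
    S = leibniz_kernel \/ S = setT.

Definition product_edge B (v v' : L) : Prop :=
  [/\ B v, B v' & exists2 w, B w &
     [set br w v; br v w] `&` punctured_line v' !=set0].

Lemma product_edge_vertices B v v' : product_edge B v v' -> B v /\ B v'.
Proof. by case. Qed.

Definition product_graph B : digraph L := Digraph (@product_edge_vertices B).

Definition weak_division BI BV : Prop :=
  (forall e_i e_k u_j (a : F), BI e_i -> BI e_k -> BV u_j ->
     br e_i u_j <> 0 -> br e_i u_j = a *: e_k ->
     ideal_generated [set e_k] e_i) /\
  (forall u_i u_k u_p (a : F), BV u_i -> BV u_k -> BV u_p ->
     br u_i u_k <> 0 -> br u_i u_k = a *: u_p ->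
     ideal_generated [set u_p] u_i /\ ideal_generated [set u_p] u_k).

End LeibnizAlgebras.

(* Main.v *)
Require Import Defs.
From mathcomp Require Import all_boot all_algebra.
From mathcomp Require Import boolp classical_sets.

Set Implicit Arguments.
Unset Strict Implicit.
Unset Printing Implicit Defensive.

Import GRing.Theory.

Local Open Scope ring_scope.
Local Open Scope classical_set_scope.

(* Let I be the Leibniz kernel. Since [L, I] = 0, an edge of the graph leaving
   BI stays in BI, and an edge inside BV comes from a product of two elements
   of BV.

   Minimality gives strong connectedness because the descendants of a basis
   vector v span an ideal with multiplicative basis, which must be I or L.
   Strong connectedness gives weak division because v' lies in the ideal
   generated by v whenever there is a path from v to v'.
   Conversely, weak division lets an ideal be propagated backwards along edges,
   so by connectedness an ideal meeting BI contains I and one meeting BV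
   contains V; in the latter case it is L, as I is generated by squares. *)

(** * Spans and linear independence in arbitrary dimension *)

Section Spans.
Variables (F : fieldType) (L : lmodType F).
Implicit Types (S V A B : set L).

Lemma is_subspaceP S :
  is_subspace S <->
  S 0 /\ forall (a : F) (x y : L), S x -> S y -> S (a *: x + y).
Proof.
split=> [[S0 Sl]|[S0 Sl]]; split.
- by rewrite -in_setE.
- by move=> a x y Sx Sy; rewrite -in_setE; apply: Sl; rewrite inE.
- by rewrite inE.
- by move=> a x y; rewrite !inE; apply: Sl.
Qed.

Lemma subspace0 S : is_subspace S -> S 0.
Proof. by case/is_subspaceP. Qed.

Lemma subspaceD S x y : is_subspace S -> S x -> S y -> S (x + y).
Proof. by case/is_subspaceP=> _ Sl Sx Sy; rewrite -[x]scale1r; apply: Sl. Qed.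

Lemma subspaceZ S a x : is_subspace S -> S x -> S (a *: x).
Proof.
by case/is_subspaceP=> S0 Sl Sx; rewrite -[_ *: _]addr0; apply: Sl.
Qed.

Lemma subspace_unscale S a x : is_subspace S -> a <> 0 -> S (a *: x) -> S x.
Proof.
move=> sS /eqP a0 Sax.
by rewrite -[x](scalerK a0); apply: subspaceZ.
Qed.

Lemma subspace_sum S (s : seq L) (c : L -> F) :
  is_subspace S -> [set` s] `<=` S -> S (\sum_(x <- s) c x *: x).
Proof.
move=> sS sub; rewrite big_seq; elim/big_ind: _ => [|x y|x xs].
- exact: subspace0.
- exact: subspaceD.
- by apply: subspaceZ => //; apply: sub.
Qed.

Lemma span_subspace A : is_subspace (linear_span A).
Proof.
apply/is_subspaceP; split=> [S [sS _]|a x y Ax Ay S [sS AS]].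
  exact: subspace0.
by apply: subspaceD => //; [apply: subspaceZ => //; apply: Ax|apply: Ay].
Qed.

Lemma sub_span A : A `<=` linear_span A.
Proof. exact: sub_gen_smallest. Qed.

Lemma span_min A S : is_subspace S -> A `<=` S -> linear_span A `<=` S.
Proof. exact: smallest_sub. Qed.

Lemma spanS A B : A `<=` B -> linear_span A `<=` linear_span B.
Proof.
by move=> AB; apply: span_min (span_subspace _) _ => x /AB /sub_span.
Qed.

(** Padding coefficients with 0 lets two combinations with different supports be added over a common
    list. *)
Lemma sum_widen (s t : seq L) (c : L -> F) :
  uniq s -> uniq t -> {subset s <= t} ->
  \sum_(x <- s) c x *: x = \sum_(x <- t) (if x \in s then c x else 0) *: x.
Proof.
move=> us ut st; rewrite [RHS](bigID (mem s)) /= [X in _ + X]big1 ?addr0.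
  rewrite -[RHS]big_filter [RHS](eq_big_seq (fun x => c x *: x)); last first.
    by move=> x; rewrite mem_filter => /andP[/= -> _].
  apply: perm_big; apply: uniq_perm => // [|x]; first exact: filter_uniq.
  by rewrite mem_filter /=; case: (boolP (x \in s)) => //= /st.
by move=> x /negPf ->; rewrite scale0r.
Qed.

(** The finite combinations form a subspace containing [A], so the smallest such subspace lies among
    them. *)
Lemma spanP A x : linear_span A x ->
  exists s c, [/\ uniq s, [set` s] `<=` A & x = \sum_(y <- s) c y *: y].
Proof.
pose S := [set x | exists s (c : L -> F),
  [/\ uniq s, [set` s] `<=` A & x = \sum_(y <- s) c y *: y]].
apply: (span_min (S := S)) => [|y Ay]; last first.
  exists [:: y], (fun=> 1); split=> // [z|].
    by rewrite /= inE => /eqP ->.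
  by rewrite big_seq1 scale1r.
apply/is_subspaceP; split=> [|a _ _ [s [c [us sA ->]]] [t [d [ut tA ->]]]].
  by exists [::], (fun=> 0); split=> //; rewrite big_nil.
pose r := undup (s ++ t).
have ur : uniq r by exact: undup_uniq.
exists r, (fun x => a * (if x \in s then c x else 0) +
                    (if x \in t then d x else 0)); split=> // [z /=|].
  by rewrite mem_undup mem_cat => /orP[/sA|/tA].
rewrite (sum_widen c us ur) 1?(sum_widen d ut ur) => [|z zt|z zs].
- rewrite scaler_sumr -big_split /=; apply: eq_bigr => z _.
  by rewrite scalerDl scalerA.
- by rewrite mem_undup mem_cat zt orbT.
- by rewrite mem_undup mem_cat zs.
Qed.

Lemma independentS A B :
  A `<=` B -> linearly_independent B -> linearly_independent A.
Proof. by move=> AB iB s c us sA; apply: iB => // x /sA /AB. Qed.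

Lemma independent_neq0 A x : linearly_independent A -> A x -> x <> 0.
Proof.
move=> iA Ax x0; have /eqP[] := oner_neq0 F.
apply: (iA [:: x] (fun=> 1) _ _ _ x (mem_head _ _)) => //.
  by move=> z; rewrite /= inE => /eqP ->.
by rewrite big_seq1 scale1r.
Qed.

(** If [x] did not occur in a combination over [A] equal to it, [x] minus that combination would be
    a nontrivial relation in [B]. This turns equalities of spans into membership in sets of basis
    vectors. *)
Lemma independent_span_mem A B x :
  linearly_independent B -> A `<=` B -> B x -> linear_span A x -> A x.
Proof.
move=> iB AB Bx /spanP[s [c [us sA xE]]].
case: (boolP (x \in s)) => [/sA //|xs].
have /eqP[] := oner_neq0 F.
pose d y := if y == x then 1 else - c y.
have <- : d x = 1 by rewrite /d eqxx.
apply: (iB (x :: s) d _ _ _ x (mem_head _ _)) => /=.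
- by rewrite xs.
- by move=> z /=; rewrite inE => /predU1P[->|/sA /AB].
rewrite big_cons /d eqxx scale1r {1}xE -big_split big_seq big1 //= => y ys.
case: eqP ys => [-> /(negP xs) //|_ _].
by rewrite scaleNr subrr.
Qed.

(** In a relation, the part over [A] is minus the part over [B], hence lies in both subspaces and is
    0; each part is then a relation of its own. *)
Lemma independentU S V A B :
  is_subspace S -> is_subspace V -> S `&` V = [set 0] ->
  A `<=` S -> B `<=` V ->
  linearly_independent A -> linearly_independent B ->
  linearly_independent (A `|` B).
Proof.
move=> sS sV SV AS BV iA iB s c us sAB s0.
pose a (x : L) := `[< A x >].
pose sA := [seq x <- s | a x]; pose sB := [seq x <- s | ~~ a x].
have subA : [set` sA] `<=` A.
  by move=> x /=; rewrite mem_filter => /andP[/asboolP].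
have subB : [set` sB] `<=` B.
  move=> x /=; rewrite mem_filter => /andP[/asboolPn nA xs].
  by case: (sAB x xs).
pose p := \sum_(x <- sA) c x *: x; pose q := \sum_(x <- sB) c x *: x.
have pq0 : p + q = 0 by rewrite -s0 (bigID a) /= /p /q !big_filter.
have Sp : S p by apply: subspace_sum => // x /subA /AS.
have Vq : V q by apply: subspace_sum => // x /subB /BV.
have p0 : p = 0.
  have: (S `&` V) p; last by rewrite SV.
  split=> //; move/eqP: pq0; rewrite addr_eq0 => /eqP ->.
  by rewrite -scaleN1r; apply: subspaceZ.
have q0 : q = 0 by move: pq0; rewrite p0 add0r.
move=> x xs; case: (boolP (a x)) => ax.
  by apply: (iA sA) => //; rewrite ?filter_uniq // mem_filter ax.
by apply: (iB sB) => //; rewrite ?filter_uniq // mem_filter ax.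
Qed.

End Spans.

(** * Directed paths *)

Section Paths.
Variables (T : Type) (e : T -> T -> Prop).

Lemma joined_refl v : joined_by_path e v v.
Proof. by exists [::]. Qed.

Lemma joined_rcons v w x :
  joined_by_path e v w -> e w x -> joined_by_path e v x.
Proof.
move=> [p [pp pw]] ewx; exists (rcons p x); rewrite last_rcons; split=> //.
by rewrite rcons_path pp pw; apply/asboolP.
Qed.

(** Used to carry invariants of vertices along a path. *)
Lemma joined_ind (P : T -> Prop) v w : P v ->
  (forall x y, P x -> e x y -> P y) -> joined_by_path e v w -> P w.
Proof.
move=> Pv eP [p [+ <-]]; elim: p v Pv => //= x p IH v Pv /andP[/asboolP evx].
by apply: IH; apply: eP evx.
Qed.

End Paths.

Lemma joined_sub T (e e' : T -> T -> Prop) v w :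
  (forall x y, e x y -> e' x y) ->
  joined_by_path e v w -> joined_by_path e' v w.
Proof.
move=> ee'; apply: joined_ind (joined_refl _ _) _ => x y vx exy.
by apply: joined_rcons vx _; apply: ee'.
Qed.

Lemma strongly_connected_connected T (H : digraph T) :
  strongly_connected H -> connected_graph H.
Proof.
move=> sc v w Hv Hw _; have [vw _] := sc v w Hv Hw.
by apply: joined_sub vw => x y; left.
Qed.

(** * Ideals and their stability along edges *)

Section Ideals.
Variables (F : fieldType) (L : lmodType F) (br : {bilinear L -> L -> L}).
Implicit Types (S A B : set L).

Lemma ideal_generated_ideal A : is_ideal br (ideal_generated br A).
Proof.
split.
  apply/is_subspaceP; split=> [S [[sS _] _]|a x y Ax Ay S [iS AS]].
    exact: subspace0.
  case: (iS) => sS _.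
  by apply: subspaceD => //; [apply: subspaceZ => //; apply: Ax|apply: Ay].
by move=> s x As; split=> S [iS AS]; case: (iS.2 s x (As S (conj iS AS))).
Qed.

Lemma mem_ideal_generated v : ideal_generated br [set v] v.
Proof. exact: sub_gen_smallest. Qed.

Lemma ideal_generated_min S v w :
  is_ideal br S -> S v -> ideal_generated br [set v] w -> S w.
Proof. by move=> iS Sv; apply: smallest_sub => // _ ->. Qed.

(** The product giving the edge lies in [S], and its coefficient is nonzero, so it can be divided
    out. *)
Lemma product_edge_ideal B S v v' :
  is_ideal br S -> S v -> product_edge br B v v' -> S v'.
Proof.
move=> [sS iS] Sv [_ _ [w _ [z [zE [a /= a0 az]]]]].
have [Svw Swv] := iS v w Sv.
by apply: (subspace_unscale sS a0); rewrite az; case: zE => ->.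
Qed.

Lemma product_closed_line B A v w :
  closed_multiplicatively br B -> A `<=` B ->
  (forall x y, A x -> product_edge br B x y -> A y) ->
  A v -> B w ->
  (exists2 z, A z & line z (br v w)) /\ (exists2 z, A z & line z (br w v)).
Proof.
move=> cB AB cA Av Bw.
have aux t : t = br v w \/ t = br w v -> (exists2 z, B z & line z t) ->
    exists2 z, A z & line z t.
  move=> tE [z Bz [a _ at_]].
  (* A zero product lies on the line of [v], which is in [A]; a nonzero coefficient makes [z] the
     target of an edge from [v]. *)
  have [a0|/eqP a0] := eqVneq a 0.
    by exists v => //; exists 0 => //; rewrite -at_ a0 !scale0r.
  exists z; last by exists a.
  apply: (cA v) => //; split=> //; first exact: AB.
  exists w => //; exists t; split; last by exists a.
  by case: tE => ->; [right|left].
have Bv := AB _ Av.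
by split; apply: aux; [left| apply: cB|right|apply: cB].
Qed.

Lemma span_ideal B A :
  linear_span B = setT -> closed_multiplicatively br B -> A `<=` B ->
  (forall x y, A x -> product_edge br B x y -> A y) ->
  is_ideal br (linear_span A).
Proof.
move=> spB cB AB cA; have sA := span_subspace A; split=> // s x; move: s.
(* Products of [A] with [B] lie in the span of [A]; linearity extends this from [A] to its span
   through [S1], then from [B] to the whole algebra through [S2]. *)
pose S1 x := [set s | linear_span A (br s x) /\ linear_span A (br x s)].
pose S2 := [set x | linear_span A `<=` S1 x].
have sS1 y : is_subspace (S1 y).
  apply/is_subspaceP; split=> [|a s t [Ays Asy] [Ayt Aty]].
    by rewrite /S1 /= linear0l linear0r; split; apply: (subspace0 sA).
  rewrite /S1 /= linearPl linearPr.
  by split; apply: (subspaceD sA) => //; apply: (subspaceZ _ sA).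
have sS2 : is_subspace S2.
  apply/is_subspaceP; split=> [s _|a y z S2y S2z s As].
    by rewrite /S1 /= linear0l linear0r; split; apply: (subspace0 sA).
  rewrite /S1 /= linearPl linearPr.
  have [? ?] := S2y s As; have [? ?] := S2z s As.
  by split; apply: (subspaceD sA) => //; apply: (subspaceZ _ sA).
suff BS2 : B `<=` S2.
  by have : linear_span B x by [rewrite spB]; move/(span_min sS2 BS2).
move=> w Bw; suff AS1 : A `<=` S1 w by move=> t /(span_min (sS1 w) AS1).
move=> v Av.
have [[z Az [a _ vw]] [z' Az' [a' _ wv]]] :=
  product_closed_line cB AB cA Av Bw.
by rewrite /S1 /= -vw -wv; split; apply: (subspaceZ _ sA); apply: sub_span.
Qed.

(** The elements killed by every left multiplication form an ideal, by the Leibniz identity. It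
    contains each square: expanding [br (br w y) y] returns the same term plus [br w (br y y)]. *)
Lemma br_leibniz_kernel x z :
  leibniz_identity br -> leibniz_kernel br z -> br x z = 0.
Proof.
move=> leib; pose Z := [set z | forall y, br y z = 0].
suff: leibniz_kernel br `<=` Z by move=> /[apply].
apply: smallest_sub => [|_ [y _ <-] w]; last first.
  by apply: (addrI (br (br w y) y)); rewrite addr0 -leib.
split=> [|s y Zs].
  apply/is_subspaceP; split=> [y|a s t Zs Zt y]; first exact: linear0r.
  by rewrite linearPr Zs Zt scaler0 addr0.
split=> w; last by rewrite Zs linear0r.
by have := leib y w s; rewrite !Zs linear0l add0r => <-.
Qed.

End Ideals.

(** * The basis adapted to the kernel and its complement, and its edges *)

Section LeibnizBasis.
Variables (F : fieldType) (L : lmodType F) (br : {bilinear L -> L -> L}).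
Variables (V BI BV : set L).
Hypothesis leib : leibniz_identity br.
Hypothesis compl : linear_complement (leibniz_kernel br) V.
Hypothesis mb : multiplicative_basis br V BI BV.

Local Notation I := (leibniz_kernel br).
Local Notation B := (BI `|` BV).
Local Notation G := (product_graph br B).

Lemma kernel_ideal : is_ideal br I.
Proof. exact: ideal_generated_ideal. Qed.

Lemma sub_BI_kernel : BI `<=` I.
Proof. by case: mb => -[_ <-] _ _ _; apply: sub_span. Qed.

Lemma sub_BV_complement : BV `<=` V.
Proof. by case: mb => _ [_ <-] _ _; apply: sub_span. Qed.

Lemma B_independent : linearly_independent B.
Proof.
case: mb compl => -[iI _] [iV _] _ _ [sV IV _].
apply: independentU sV IV sub_BI_kernel sub_BV_complement iI iV.
by case: kernel_ideal.
Qed.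

Lemma BV_notin_kernel u : BV u -> ~ I u.
Proof.
move=> BVu Iu; apply: (independent_neq0 B_independent (or_intror BVu)).
case: compl => _ + _ => /seteqP[+ _]; apply; split=> //.
exact: sub_BV_complement.
Qed.

Lemma BI_of_kernel v : B v -> I v -> BI v.
Proof. by case=> // /BV_notin_kernel. Qed.

Lemma B_span : linear_span B = setT.
Proof.
rewrite -subTset => x _.
case: mb compl => -[_ <-] [_ <-] _ _ [_ _] /seteqP[_ /(_ x Logic.I)].
move=> [y yI [z zV <-]]; apply: subspaceD (span_subspace _) _ _.
  by apply: spanS yI => w; left.
by apply: spanS zV => w; right.
Qed.

Lemma B_closed : closed_multiplicatively br B.
Proof.
case: mb => _ _ eu uu v w.
(* A right factor in the kernel gives product 0, which lies on any line. *)
have kernelr z : BI w -> B z -> exists2 t, B t & line t (br z w).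
  move=> BIw _; exists w; first by left.
  exists 0 => //; rewrite scale0r br_leibniz_kernel //.
  exact: sub_BI_kernel.
move=> Bv [BIw|BVw]; first exact: kernelr.
case: Bv => [BIv|BVv].
  by have [e BIe le] := eu _ _ BIv BVw; exists e => //; left.
by have [[t Bt lt]|[t Bt lt]] := uu _ _ BVv BVw; exists t => //; [right|left].
Qed.

(** The kernel is an ideal and contains no vector of [BV]. *)
Lemma edge_from_BI v w : BI v -> edge G v w -> BI w.
Proof.
move=> BIv vw; have [_ Bw _] := vw; apply: BI_of_kernel => //.
apply: (product_edge_ideal kernel_ideal) vw.
exact: sub_BI_kernel.
Qed.

(** A right factor in the kernel would make the product vanish, so [v] is the left factor and the
    other factor is in [BV]: the form that weak division handles. *)
Lemma edge_from_BI_product v w : BI v -> edge G v w ->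
  exists u a, [/\ BV u, br v u <> 0 & br v u = a *: w].
Proof.
move=> BIv [_ Bw [u Bu [z [zE [a /= a0 az]]]]].
have z0 : z <> 0.
  move=> z0; apply: (independent_neq0 B_independent Bw).
  apply/eqP; have := eqxx z; rewrite {1}z0 -az eq_sym scaler_eq0.
  by case/orP => // /eqP.
have Iv := sub_BI_kernel BIv.
case: zE => zE; first by case: z0; rewrite zE br_leibniz_kernel.
case: Bu => [/sub_BI_kernel Iu|BVu].
  by case: z0; rewrite zE br_leibniz_kernel.
by exists u, a; rewrite -zE.
Qed.

(** A nonzero multiple of [w] is outside the kernel, so no factor of the product is in this
    ideal. *)
Lemma edge_to_BV_product v w : BV v -> BV w -> edge G v w ->
  exists u a z, [/\ BV u, z = br u v \/ z = br v u, z <> 0 & z = a *: w].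
Proof.
move=> BVv BVw [_ Bw [u Bu [z [zE [a /= a0 az]]]]].
have nIz : ~ I z.
  rewrite -az => /(subspace_unscale kernel_ideal.1 a0).
  exact: BV_notin_kernel.
have BVu : BV u.
  case: Bu => // /sub_BI_kernel Iu.
  have [Iuv Ivu] := kernel_ideal.2 u v Iu.
  by case: nIz; case: zE => ->.
exists u, a, z; split=> // z0; apply: nIz; rewrite z0.
exact: subspace0 kernel_ideal.1.
Qed.

Lemma kernel_min S : is_ideal br S -> BI `<=` S -> I `<=` S.
Proof. by case: mb => -[_ <-] _ _ _ [sS _]; apply: span_min. Qed.

(* Since [L, I] = 0, the square of x + v with x in I and v in V equals
   [x, v] + [v, v], which lies in any ideal containing V. *)
Lemma ideal_full S : is_ideal br S -> BV `<=` S -> S = setT.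
Proof.
move=> iS BVS; have [sS mS] := iS.
have VS : V `<=` S by case: mb => _ [_ <-] _ _; apply: span_min.
have [_ _ /seteqP[_ IV]] := compl.
have IS : I `<=` S.
  apply: smallest_sub => // _ [x _ <-].
  have [y yI [v vV <-]] := IV x Logic.I.
  rewrite linearDl !linearDr !(br_leibniz_kernel _ leib yI) add0r add0r.
  by have [? ?] := mS v y (VS _ vV); have [? _] := mS v v (VS _ vV);
     apply: subspaceD.
rewrite -subTset => x _; have [y yI [v vV <-]] := IV x Logic.I.
by apply: subspaceD => //; [apply: IS|apply: VS].
Qed.

(** * From minimality to strong connectedness *)

Definition descendants v : set L := [set w | joined_by_path (edge G) v w].

Lemma descendants_sub v : B v -> descendants v `<=` B.
Proof. by move=> Bv w; apply: joined_ind Bv _ => x y _ []. Qed.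

Lemma descendants_ideal v : B v -> is_ideal br (linear_span (descendants v)).
Proof.
move=> Bv; apply: span_ideal B_span B_closed (descendants_sub Bv) _ => x y.
exact: joined_rcons.
Qed.

Lemma minimal_descendants v : minimal_algebra br B -> B v ->
  linear_span (descendants v) = I \/ linear_span (descendants v) = setT.
Proof.
move=> minB Bv; have subB := descendants_sub Bv.
have Dv : descendants v v by apply: joined_refl.
apply: minB (descendants_ideal Bv) _ _ => [D0|].
  apply: (independent_neq0 B_independent Bv).
  by have := sub_span Dv; rewrite D0.
exists (descendants v); split=> //.
  by split=> //; apply: independentS subB B_independent.
move=> x y Dx Dy.
have cD s t : descendants v s -> edge G s t -> descendants v t.
  exact: joined_rcons.
by have [] := product_closed_line B_closed subB cD Dx (subB _ Dy).
Qed.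

(** Whether the descendants of [v] span I or L, the span contains [w], so [w] is a descendant by
    independence. *)
Lemma minimal_strongly_connected_BI :
  minimal_algebra br B -> strongly_connected (induced_subgraph G BI).
Proof.
move=> minB; suff dir v w : BI v -> BI w ->
    joined_by_path (edge (induced_subgraph G BI)) v w.
  by move=> v w [_ BIv] [_ BIw]; split; apply: dir.
move=> BIv BIw.
have Dw : descendants v w.
  apply: (independent_span_mem B_independent); last 1 first.
  - have [->|-> //] := minimal_descendants minB (or_introl BIv).
    exact: sub_BI_kernel.
  - by apply: descendants_sub; left.
  - by left.
(* A path starting in [BI] stays there, hence is a path of the induced subgraph. *)
pose P w := BI w /\ joined_by_path (edge (induced_subgraph G BI)) v w.
suff [] : P w by [].
apply: (joined_ind (P := P) _ _ Dw) => [|x y [BIx vx] xy].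
  by split=> //; apply: joined_refl.
have BIy := edge_from_BI BIx xy.
by split=> //; apply: joined_rcons vx _.
Qed.

(** The descendants of [v] cannot span I, since [v] is outside it; they span L, so [w] is among
    them. *)
Lemma minimal_strongly_connected_BV :
  minimal_algebra br B -> strongly_connected (induced_subgraph G BV).
Proof.
move=> minB; suff dir v w : BV v -> BV w ->
    joined_by_path (edge (induced_subgraph G BV)) v w.
  by move=> v w [_ BVv] [_ BVw]; split; apply: dir.
move=> BVv BVw; have nBI u : BV u -> ~ BI u.
  by move=> /BV_notin_kernel nI /sub_BI_kernel.
have Dw : descendants v w.
  apply: (independent_span_mem B_independent); last 1 first.
  - have [DI|-> //] := minimal_descendants minB (or_intror BVv).
    exfalso; apply: (BV_notin_kernel BVv); rewrite -DI; apply: sub_span.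
    exact: joined_refl.
  - by apply: descendants_sub; right.
  - by right.
(* No edge leaves BI, so a path ending in BV never meets BI. *)
pose P w := BI w \/ BV w /\ joined_by_path (edge (induced_subgraph G BV)) v w.
suff : P w by case=> [/(nBI _ BVw)|[]].
apply: (joined_ind (P := P) _ _ Dw) => [|x y [BIx|[BVx vx]] xy].
- by right; split=> //; apply: joined_refl.
- by left; apply: edge_from_BI xy.
- have [_ [BIy|BVy] _] := xy; first by left.
  by right; split=> //; apply: joined_rcons vx _.
Qed.

(** * Weak division and the return to minimality *)

Lemma joined_ideal_generated A v w :
  joined_by_path (edge (induced_subgraph G A)) v w ->
  ideal_generated br [set v] w.
Proof.
apply: (joined_ind (P := ideal_generated br [set v])).
  exact: mem_ideal_generated.
move=> x y vx [_ _]; exact: product_edge_ideal (ideal_generated_ideal _ _) vx.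
Qed.

(** A path from the basis vector of a product back to a factor puts that factor in the ideal it
    generates. *)
Lemma strongly_connected_weak_division :
  strongly_connected (induced_subgraph G BI) ->
  strongly_connected (induced_subgraph G BV) -> weak_division br BI BV.
Proof.
move=> scI scV; split=> [e f u a BIe BIf _ _ _|u v w a BVu BVv BVw _ _].
  apply: (joined_ideal_generated (A := BI)).
  by apply: (scI f e _ _).1; split=> //; left.
have joinw x : BV x -> ideal_generated br [set w] x.
  move=> BVx; apply: (joined_ideal_generated (A := BV)).
  by apply: (scV w x _ _).1; split=> //; right.
by split; apply: joinw.
Qed.

(** Undirected paths need both directions: ideals pass forward along edges by themselves, and [back]
    supplies the reverse. *)
Lemma connected_ideal_sub A S v : A `<=` B ->
  connected_graph (induced_subgraph G A) -> is_ideal br S ->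
  (forall x y, A x -> A y -> edge G x y -> S y -> S x) ->
  A v -> S v -> A `<=` S.
Proof.
move=> AB conA iS back Av Sv w Aw.
have [<- //|vw] := pselect (v = w).
have [||p] := conA v w _ _ vw; try by split=> //; apply: AB.
move=> vpw; apply: (joined_ind Sv) (ex_intro _ p vpw) => x y Sx.
case=> [[_ _]|[Ay Ax yx]]; first exact: product_edge_ideal.
exact: back yx Sx.
Qed.

Lemma weak_division_minimal : weak_division br BI BV ->
  connected_graph (induced_subgraph G BI) ->
  connected_graph (induced_subgraph G BV) -> minimal_algebra br B.
Proof.
move=> [wdI wdV] conI conV S iS S0 [A [AB [_ spA] _]].
have AS : A `<=` S by rewrite -spA; apply: sub_span.
(* If the basis [A] of [S] meets [BV], then [S] is L; otherwise [S] lies in I, and it remains to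
   show that it contains [BI]. *)
have [[u [Au BVu]]|noV] := pselect (exists u, A u /\ BV u).
  right; apply: ideal_full => //.
  apply: (connected_ideal_sub _ conV iS _ BVu (AS u Au)) => [x|]; first by right.
  move=> x y BVx BVy xy Sy.
  have [w [a [z [BVw zE z0 za]]]] := edge_to_BV_product BVx BVy xy.
  case: zE => zE; rewrite zE in z0 za.
    exact: ideal_generated_min iS Sy (wdV _ _ _ _ BVw BVx BVy z0 za).2.
  exact: ideal_generated_min iS Sy (wdV _ _ _ _ BVx BVw BVy z0 za).1.
have ABI : A `<=` BI.
  by move=> x Ax; case: (AB x Ax) => // BVx; case: noV; exists x.
left; apply/seteqP; split.
  rewrite -spA; apply: span_min kernel_ideal.1 _ => x /ABI.
  exact: sub_BI_kernel.
(* An empty [A] would span only 0, against [S] being nonzero. *)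
have [[e Ae]|noA] := pselect (exists e, A e); last first.
  case: S0; apply/seteqP; split=> [|_ ->]; last exact: subspace0 iS.1.
  rewrite -spA; apply: span_min => [|x Ax]; last by case: noA; exists x.
  apply/is_subspaceP; split=> // a x y -> ->.
  by rewrite /= scaler0 addr0.
apply: kernel_min => //.
apply: (connected_ideal_sub _ conI iS _ (ABI e Ae) (AS e Ae)) => [x|].
  by left.
move=> x y BIx BIy xy Sy.
have [u [a [BVu xu0 xuE]]] := edge_from_BI_product BIx xy.
exact: ideal_generated_min iS Sy (wdI _ _ _ _ BIx BIy BVu xu0 xuE).
Qed.

End LeibnizBasis.

Theorem theorem4p1 (F : fieldType) (L : lmodType F)
    (br : {bilinear L -> L -> L}) (V BI BV : set L) :
  leibniz_identity br ->
  linear_complement (leibniz_kernel br) V ->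
  multiplicative_basis br V BI BV ->
  let G := product_graph br (BI `|` BV) in
  [<-> minimal_algebra br (BI `|` BV);
       strongly_connected (induced_subgraph G BI) /\
       strongly_connected (induced_subgraph G BV);
       weak_division br BI BV /\
       connected_graph (induced_subgraph G BI) /\
       connected_graph (induced_subgraph G BV)].
Proof.
move=> leib compl mb G; tfae.
- move=> minB; split.
    exact: (minimal_strongly_connected_BI leib compl mb).
  exact: (minimal_strongly_connected_BV leib compl mb).
- move=> [scI scV]; split; first exact: strongly_connected_weak_division.
  by split; apply: strongly_connected_connected.
- by move=> [wd [conI conV]]; apply: (weak_division_minimal leib compl mb).
Qed.
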